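(* Let $\mathcal{U}$ be a Hopf *-algebra, $\mathcal{B}$ a unital left $\mathcal{U}$-module *-algebra, $\lambda:\mathcal{B}\to\mathcal{B}$ an automorphism of the form $\lambda(b)=k\triangleright b$ with a group-like element $k\in\mathcal{U}$, and suppose there is an automorphism $\sigma$ of $\mathcal{B}$ with $\sigma(b)^*=\sigma^{-1}(b^* )$ and $\sigma(f\triangleright b)=S^2(f)\triangleright\sigma(b)$ for all $b\in\mathcal{B}$, $f\in\mathcal{U}$. Then for each $n\in\mathbb{N}_0$ there is a (well-defined, biadditive) pairing $$\langle\cdot,\cdot\rangle:\mathrm{HC}_\lambda^{2n}(\mathcal{B})\times K_0^{\mathcal{U}}(\mathcal{B})\to\mathbb{C}$$ given by evaluating cocycles on the twisted Chern character; for a $\lambda$-twisted cyclic $2n$-cocycle $\Phi$ and an invariant projection $P$ it takes the form $$\langle[\Phi],[P]\rangle=(-1)^n\frac{(2n)!}{n!}\,\Phi\big(\mathrm{Tr}_\lambda(P\otimes P\otimes\cdots\otimes P)\big)\qquad(2n+1\ \text{factors}).$$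
   Context: Left $\mathcal{U}$-module *-algebra: $f\triangleright(xy)=(f_{(1)}\triangleright x)(f_{(2)}\triangleright y)$, $f\triangleright1=\varepsilon(f)1$, $(f\triangleright x)^*=S(f)^*\triangleright x^*$ (Sweedler notation). Group-like: $\Delta(k)=k\otimes k$, $\varepsilon(k)=1$. Equivariant $K_0$ (relative to $\sigma$): for a matrix $X$ over $\mathcal{B}$ put $X^\dagger=\sigma(X)^*$ ($\sigma$ entrywise, $*$ conjugate transpose). A projection is $P\in\mathrm{M}_{m\times m}(\mathcal{B})$ with $P^2=P=P^\dagger$. Given a finite dimensional *-representation $\rho^\circ:\mathcal{U}^\circ\to\mathrm{End}(\mathbb{C}^m)$ of the opposite algebra, $\mathrm{ad}^\circ_{\mathrm R}(f)(X)=\rho^\circ(S^{-1}(f_{(1)}))(S^{-2}(f_{(2)})\triangleright X)\rho^\circ(f_{(3)})$; $X$ is invariant with respect to $\rho^\circ$ if $\mathrm{ad}^\circ_{\mathrm R}(f)(X)=\varepsilon(f)X$ for all $f\in\mathcal{U}$. Let $\pi^\circ(f)(v\otimes a)=\rho^\circ(f_{(2)})v\otimes S^{-1}(f_{(1)})\triangleright a$ on $\mathbb{C}^m\otimes\mathcal{B}$. Invariant projections $P\in\mathrm{M}_{j\times j}(\mathcal{B})$ (with $\rho_1^\circ$), $Q\in\mathrm{M}_{m\times m}(\mathcal{B})$ (with $\rho_2^\circ$) are Murray-von Neumann equivalent if there is $V\in\mathrm{M}_{m\times j}(\mathcal{B})$ with $V^\dagger V=P$, $VV^\dagger=Q$,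 $\pi_2^\circ(f)V=V\pi_1^\circ(f)$ for all $f$. $K_0^{\mathcal{U}}(\mathcal{B})$ is the Grothendieck group of the semigroup of equivalence classes of invariant projections of all sizes with $[P]+[Q]=[\mathrm{diag}(P,Q)]$ (with $\rho_1^\circ\oplus\rho_2^\circ$) and $0=[0]$. Quantum trace: for $A_i=(a^i_{rs})\in\mathrm{M}_{m\times m}(\mathcal{B})$, $\mathrm{Tr}_\lambda(A_0\otimes\cdots\otimes A_n)=\sum_{j_0,\dots,j_{n+1}}\rho^\circ(k)_{j_{n+1},j_0}\,a^0_{j_0,j_1}\otimes\cdots\otimes a^n_{j_n,j_{n+1}}\in\mathcal{B}^{\otimes(n+1)}$. The twisted Chern character of $[P]$ is represented by $\mathrm{ch}^\lambda_{2n}(P)=(-1)^n\frac{(2n)!}{n!}\mathrm{Tr}_\lambda(P^{\otimes(2n+1)})$. Twisted cyclic cohomology $\mathrm{HC}^*_\lambda(\mathcal{B})$: the cohomology of the complex whose $n$-cochains are the $(n+1)$-linear forms $\phi$ on $\mathcal{B}$ with $\phi(a_0,\dots,a_n)=(-1)^n\phi(\lambda(a_n),a_0,\dots,a_{n-1})$, with coboundary $(b^{\lambda*}_n\phi)(a_0,\dots,a_n)=\sum_{j=0}^{n-1}(-1)^j\phi(a_0,\dots,a_ja_{j+1},\dots,a_n)+(-1)^n\phi(\lambda(a_n)a_0,a_1,\dots,a_{n-1})$ on $(n-1)$-cochains. A $\lambda$-twisted cyclic $n$-cocycle is an $n$-cochain $\phi$ with $b^{\lambda*}_{n+1}\phi=0$.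 Multilinear forms are identified with linear functionals on tensor powers. *)

(* Defs.v *)
From HB Require Import structures.
From mathcomp Require Import all_boot all_order all_algebra.
From mathcomp Require Import boolp functions reals complex.
From mathcomp Require Import freeg.

Set Implicit Arguments.
Unset Strict Implicit.
Unset Printing Implicit Defensive.

Import GRing.Theory Num.Theory.
Local Open Scope ring_scope.

(** An element of an algebraic tensor product is given by a formal sum of
    elementary tensors, that is, by a sequence of tuples.  By the universal
    property, two formal sums denote the same tensor if and only if every
    multilinear map takes the same value on them. *)

Section Tensors.
Variables (C : comNzRingType) (V1 V2 V3 : lmodType C).

Definition bilinear_map (W : lmodType C) (b : V1 -> V2 -> W) : Prop :=
  (forall y, linear (b^~ y)) /\ (forall x, linear (b x)).

Definition trilinear_map (W : lmodType C) (b : V1 -> V2 -> V3 -> W) : Prop :=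
  [/\ forall y z, linear (fun x => b x y z),
      forall x z, linear (fun y => b x y z)
    & forall x y, linear (b x y)].

Definition tens2_eq (s t : seq (V1 * V2)) : Prop :=
  forall (W : lmodType C) (b : V1 -> V2 -> W), bilinear_map b ->
    \sum_(p <- s) b p.1 p.2 = \sum_(p <- t) b p.1 p.2.

Definition tens3_eq (s t : seq (V1 * V2 * V3)) : Prop :=
  forall (W : lmodType C) (b : V1 -> V2 -> V3 -> W), trilinear_map b ->
    \sum_(p <- s) b p.1.1 p.1.2 p.2 = \sum_(p <- t) b p.1.1 p.1.2 p.2.

End Tensors.

(** *-algebras over the field [C], in the application the complex numbers *)
HB.mixin Record Algebra_isStar (C : numClosedFieldType) A
    of GRing.Algebra C A := {
  star : A -> A;
  starK : involutive star;
  starP : forall (c : C) (x y : A),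
    star (c *: x + y) = c^* *: star x + star y;
  starM : forall x y : A, star (x * y) = star y * star x
}.

#[short(type="starAlgType")]
HB.structure Definition StarAlgebra (C : numClosedFieldType) :=
  {A of GRing.Algebra C A & Algebra_isStar C A}.

(** Hopf *-algebras.  [comul f] is a formal sum representing the coproduct of
    [f], so that [\sum_(p <- comul f) F p.1 p.2] renders the Sweedler
    expression [F f_(1) f_(2)].  The last two axioms follow from the others;
    as usual they are made part of the definition. *)
HB.mixin Record StarAlgebra_isHopf (C : numClosedFieldType) U
    of StarAlgebra C U := {
  comul : U -> seq (U * U);
  counit : U -> C;
  antipode : U -> U;
  comul_linear : forall (c : C) (f g : U),
    tens2_eq (comul (c *: f + g))
      ([seq (c *: p.1, p.2) | p <- comul f] ++ comul g);
  comul1 : tens2_eq (comul 1) [:: (1, 1)];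
  comulM : forall f g : U,
    tens2_eq (comul (f * g))
      [seq (p.1 * q.1, p.2 * q.2) | p <- comul f, q <- comul g];
  comulA : forall f : U,
    tens3_eq [seq (q.1, q.2, p.2) | p <- comul f, q <- comul p.1]
             [seq (p.1, q.1, q.2) | p <- comul f, q <- comul p.2];
  counit_scalar : scalar counit;
  counit1 : counit 1 = 1;
  counitM : {morph counit : f g / f * g};
  counitl : forall f : U, \sum_(p <- comul f) counit p.1 *: p.2 = f;
  counitr : forall f : U, \sum_(p <- comul f) counit p.2 *: p.1 = f;
  antipode_linear : linear antipode;
  antipodel : forall f : U,
    \sum_(p <- comul f) antipode p.1 * p.2 = (counit f)%:A;
  antipoder : forall f : U,
    \sum_(p <- comul f) p.1 * antipode p.2 = (counit f)%:A;
  comul_star : forall f : U,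
    tens2_eq (comul (star f)) [seq (star p.1, star p.2) | p <- comul f];
  counit_star : forall f : U, counit (star f) = (counit f)^*;
  antipode_star : forall f : U, antipode (star (antipode (star f))) = f
}.

#[short(type="hopfStarAlgType")]
HB.structure Definition HopfStarAlgebra (C : numClosedFieldType) :=
  {U of StarAlgebra C U & StarAlgebra_isHopf C U}.

Section HopfDefs.
Variables (C : numClosedFieldType) (U : hopfStarAlgType C).

(** The inverse of the antipode of a Hopf *-algebra is [f |-> S(f^* )^*]. *)
Definition antipodeV (f : U) : U := star (antipode (star f)).

Lemma antipodeVK : cancel antipodeV (@antipode C U).
Proof. exact: antipode_star. Qed.

Lemma antipodeK : cancel (@antipode C U) antipodeV.
Proof.
by move=> f; apply: (can_inj starK); rewrite starK -[RHS]antipode_star starK.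
Qed.

Definition group_like (k : U) : Prop :=
  tens2_eq (comul k) [:: (k, k)] /\ counit k = 1.

End HopfDefs.

(** Left module *-algebras over a Hopf *-algebra *)
HB.mixin Record StarAlgebra_isModule (C : numClosedFieldType)
    (U : hopfStarAlgType C) B of StarAlgebra C B := {
  act : U -> B -> B;
  act_bilinear : bilinear_map act;
  act1 : forall x : B, act 1 x = x;
  actA : forall (f g : U) (x : B), act (f * g) x = act f (act g x);
  actM : forall (f : U) (x y : B),
    act f (x * y) = \sum_(p <- comul f) act p.1 x * act p.2 y;
  act_unit : forall f : U, act f 1 = (counit f)%:A;
  act_star : forall (f : U) (x : B),
    star (act f x) = act (star (antipode f)) (star x)
}.

#[short(type="moduleStarAlgType")]
HB.structure Definition ModuleStarAlgebra (C : numClosedFieldType)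
    (U : hopfStarAlgType C) :=
  {B of StarAlgebra C B & StarAlgebra_isModule C U B}.

(** Automorphisms of the unital algebra [B]; they need not preserve [star]. *)
Record algAut (C : numClosedFieldType) (B : algType C) := AlgAut {
  aut_fun :> {lrmorphism B -> B};
  aut_inv : B -> B;
  aut_funK : cancel aut_fun aut_inv;
  aut_invK : cancel aut_inv aut_fun
}.

(** Unital finite dimensional *-representations on [C^m] of the opposite
    algebra of [U] *)
Record opStarRep (C : numClosedFieldType) (U : starAlgType C) (m : nat) :=
  OpStarRep {
    rep_fun :> U -> 'M[C]_m;
    rep_linear : linear rep_fun;
    rep1 : rep_fun 1 = 1%:M;
    repM : forall f g, rep_fun (f * g) = rep_fun g *m rep_fun f;
    rep_star : forall f, rep_fun (star f) = map_mx Num.conj (rep_fun f)^T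
  }.

Section EquivariantK0.
Variables (C : numClosedFieldType) (U : hopfStarAlgType C).
Variables (B : moduleStarAlgType U) (sigma : algAut B).

Local Notation emb := (map_mx (in_alg B)).
Local Notation Sinv := (@antipodeV C U).
Local Notation act_mx f := (map_mx (@act C U B f)).

Definition dagger m j (X : 'M[B]_(m, j)) : 'M[B]_(j, m) :=
  map_mx star (map_mx sigma X)^T.

Definition adR m (rho : opStarRep U m) (f : U) (X : 'M[B]_m) : 'M[B]_m :=
  \sum_(p <- comul f) \sum_(q <- comul p.2)
    emb (rho (Sinv p.1)) *m act_mx (Sinv (Sinv q.1)) X *m emb (rho q.2).

Definition invariant_mx m (rho : opStarRep U m) (X : 'M[B]_m) : Prop :=
  forall f : U, adR rho f X = (counit f)%:A *: X.

(** The tensor product of [C^m] and [B] is identified with the column vectors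
    over [B]. *)
Definition pi_op m (rho : opStarRep U m) (f : U) (x : 'cV[B]_m) : 'cV[B]_m :=
  \sum_(p <- comul f) emb (rho p.2) *m act_mx (Sinv p.1) x.

Record invProj := InvProj {
  ip_dim : nat;
  ip_rep : opStarRep U ip_dim;
  ip_mx :> 'M[B]_ip_dim;
  ip_idem : ip_mx *m ip_mx = ip_mx;
  ip_dagger : dagger ip_mx = ip_mx;
  ip_inv : invariant_mx ip_rep ip_mx
}.

HB.instance Definition _ := gen_eqMixin invProj.
HB.instance Definition _ := gen_choiceMixin invProj.

Definition MvN_equiv (P Q : invProj) : Prop :=
  exists V : 'M[B]_(ip_dim Q, ip_dim P),
    [/\ dagger V *m V = P,
        V *m dagger V = Q
      & forall (f : U) (x : 'cV[B]_(ip_dim P)),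
          pi_op (ip_rep Q) f (V *m x) = V *m pi_op (ip_rep P) f x].

Section DirectSum.
Variables (m1 m2 : nat) (r1 : opStarRep U m1) (r2 : opStarRep U m2).

Definition rep_dsum_fun (f : U) : 'M[C]_(m1 + m2) :=
  block_mx (r1 f) 0 0 (r2 f).

Lemma rep_dsum_linear : linear rep_dsum_fun.
Proof.
move=> c f g; rewrite /rep_dsum_fun !rep_linear scale_block_mx add_block_mx.
by rewrite !scaler0 !addr0.
Qed.

Lemma rep_dsum1 : rep_dsum_fun 1 = 1%:M.
Proof. by rewrite /rep_dsum_fun !rep1 -scalar_mx_block. Qed.

Lemma rep_dsumM f g : rep_dsum_fun (f * g) = rep_dsum_fun g *m rep_dsum_fun f.
Proof.
by rewrite /rep_dsum_fun mulmx_block !repM !mul0mx !mulmx0 !addr0 !add0r.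
Qed.

Lemma rep_dsum_star f :
  rep_dsum_fun (star f) = map_mx Num.conj (rep_dsum_fun f)^T.
Proof.
by rewrite /rep_dsum_fun tr_block_mx map_block_mx !rep_star !trmx0 !map_mx0.
Qed.

Definition rep_dsum : opStarRep U (m1 + m2) :=
  OpStarRep rep_dsum_linear rep_dsum1 rep_dsumM rep_dsum_star.

End DirectSum.

Lemma act_additive (f : U) : zmod_morphism (@act C U B f).
Proof.
by move=> x y; rewrite addrC -scaleN1r act_bilinear.2 scaleN1r addrC.
Qed.

HB.instance Definition _ (f : U) :=
  GRing.isZmodMorphism.Build B B (@act C U B f) (act_additive f).

Lemma star0 : star (0 : B) = 0.
Proof.
have := starP (-1 : C) (0 : B) 0; rewrite scaler0 addr0 rmorphN rmorph1 scaleN1r.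
by rewrite addNr.
Qed.

Section DiagonalSum.
Variables P Q : invProj.

Let D : 'M[B]_(ip_dim P + ip_dim Q) := block_mx P 0 0 Q.

Lemma ip_dsum_idem : D *m D = D.
Proof. by rewrite /D mulmx_block !mul0mx !mulmx0 !addr0 !add0r !ip_idem. Qed.

Lemma ip_dsum_dagger : dagger D = D.
Proof.
have map0 m j : map_mx star (0 : 'M[B]_(m, j)) = 0.
  by apply/matrixP => i l; rewrite !mxE star0.
rewrite /dagger /D map_block_mx tr_block_mx map_block_mx !map_mx0 !trmx0 !map0.
by rewrite -![map_mx star _]/(dagger _) !ip_dagger.
Qed.

Lemma ip_dsum_inv : invariant_mx (rep_dsum (ip_rep P) (ip_rep Q)) D.
Proof.
move=> f; rewrite /D scale_block_mx !scaler0.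
rewrite -(ip_inv P f) -(ip_inv Q f) /adR.
have sum_block (I : Type) (s : seq I) (F : I -> 'M[B]_(ip_dim P)) G :
    \sum_(i <- s) (block_mx (F i) 0 0 (G i) : 'M[B]_(ip_dim P + ip_dim Q))
    = block_mx (\sum_(i <- s) F i) 0 0 (\sum_(i <- s) G i).
  elim: s => [|i s IHs]; first by rewrite !big_nil block_mx0.
  by rewrite !big_cons IHs add_block_mx !addr0.
rewrite -sum_block; apply: eq_bigr => p _.
rewrite -sum_block; apply: eq_bigr => q _.
rewrite /= /rep_dsum_fun !map_block_mx !map_mx0 !mulmx_block.
by rewrite !mul0mx !mulmx0 !addr0 !add0r !mul0mx.
Qed.

Definition ip_dsum : invProj :=
  InvProj ip_dsum_idem ip_dsum_dagger ip_dsum_inv.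

End DiagonalSum.

(** The Grothendieck group of the semigroup of classes: the free abelian group
    on the invariant projections, modulo the subgroup [K0_null] generated by
    the relations [[P] = [Q]] for equivalent [P] and [Q], and
    [[P] + [Q] = [diag(P, Q)]].  The class of a zero projection is then zero,
    see [K0_class0]. *)
Inductive K0_null : {freeg invProj} -> Prop :=
| K0_null0 : K0_null 0
| K0_nullB x y : K0_null x -> K0_null y -> K0_null (x - y)
| K0_null_equiv P Q : MvN_equiv P Q -> K0_null (<< P >> - << Q >>)
| K0_null_dsum P Q : K0_null (<< P >> + << Q >> - << ip_dsum P Q >>).

Definition K0_null_pred : {pred {freeg invProj}} := fun x => `[< K0_null x >].

Lemma K0_null_zmod : zmod_closed K0_null_pred.
Proof.
split=> [|x y /asboolP x0 /asboolP y0]; apply/asboolP; first exact: K0_null0.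
exact: K0_nullB.
Qed.

HB.instance Definition _ :=
  GRing.isZmodClosed.Build {freeg invProj} K0_null_pred K0_null_zmod.

Definition K0 : zmodType := {ideal_quot K0_null_pred}.

Definition K0_class (P : invProj) : K0 :=
  \pi_({ideal_quot K0_null_pred})%qT << P >>.

Lemma K0_class_equiv P Q : MvN_equiv P Q -> K0_class P = K0_class Q.
Proof.
move=> PQ; apply/eqP; rewrite -Quotient.idealrBE; apply/asboolP.
exact: K0_null_equiv.
Qed.

Lemma K0_class_dsum P Q : K0_class (ip_dsum P Q) = K0_class P + K0_class Q.
Proof.
rewrite /K0_class -[RHS]raddfD; apply/esym/eqP.
by rewrite -Quotient.idealrBE; apply/asboolP/K0_null_dsum.
Qed.

Lemma K0_class0 P : ip_mx P = 0 -> K0_class P = 0.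
Proof.
move=> P0; apply: (addrI (K0_class P)); rewrite -K0_class_dsum addr0.
have dagger0 m j : dagger (0 : 'M[B]_(m, j)) = 0.
  by apply/matrixP => i l; rewrite !mxE rmorph0 star0.
have DE : ip_mx (ip_dsum P P) = 0 by rewrite /= P0 block_mx0.
apply/esym/K0_class_equiv; exists 0; rewrite DE P0; split.
- by rewrite mulmx0.
- by rewrite mul0mx.
move=> f x; rewrite !mul0mx /pi_op big1 // => p _.
by rewrite map_mx0 mulmx0.
Qed.

End EquivariantK0.

Section TwistedCyclicCohomology.
Variables (C : numClosedFieldType) (B : algType C) (lam : algAut B).

(** A function of [n.+1] variables in [B], as a function on tuples *)
Local Notation form n := ({ffun 'I_n.+1 -> B} -> C).

Definition upd n (a : {ffun 'I_n.+1 -> B}) (i : 'I_n.+1) (x : B) :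
    {ffun 'I_n.+1 -> B} :=
  [ffun j => if j == i then x else a j].

Definition multilinear_form n (phi : form n) : Prop :=
  forall a i (c : C) (x y : B),
    phi (upd a i (c *: x + y)) = c * phi (upd a i x) + phi (upd a i y).

(** [(lam a_n, a_0, ..., a_{n-1})] *)
Definition twrot n (a : {ffun 'I_n.+1 -> B}) : {ffun 'I_n.+1 -> B} :=
  [ffun i : 'I_n.+1 => if i == ord0 then lam (a ord_max) else a (inord i.-1)].

(** [(a_0, ..., a_j a_{j+1}, ..., a_{n+1})] *)
Definition face n (j : nat) (a : {ffun 'I_n.+2 -> B}) : {ffun 'I_n.+1 -> B} :=
  [ffun i : 'I_n.+1 =>
     if (i < j)%N then a (inord i)
     else if i == j :> nat then a (inord i) * a (inord i.+1)
     else a (inord i.+1)].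

(** [(lam (a_{n+1}) a_0, a_1, ..., a_n)] *)
Definition last_face n (a : {ffun 'I_n.+2 -> B}) : {ffun 'I_n.+1 -> B} :=
  [ffun i : 'I_n.+1 =>
     if i == ord0 then lam (a ord_max) * a ord0 else a (inord i)].

Definition is_cochain n (phi : form n) : Prop :=
  multilinear_form phi /\
  forall a, phi a = (-1) ^+ n * phi (twrot a).

Definition cobdry n (phi : form n) : form n.+1 := fun a =>
  \sum_(j < n.+1) (-1) ^+ j * phi (face j a)
  + (-1) ^+ n.+1 * phi (last_face a).

Definition is_cocycle n (phi : form n) : Prop :=
  is_cochain phi /\ forall a, cobdry phi a = 0.

Definition is_coboundary n : form n -> Prop :=
  match n with
  | 0 => fun phi => phi = 0
  | m.+1 => fun phi => exists2 psi : form m, is_cochain psi & phi = cobdry psi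
  end.

Lemma formBE n (phi psi : form n) a : (phi - psi) a = phi a - psi a.
Proof. by []. Qed.

Lemma cochainB n (phi psi : form n) :
  is_cochain phi -> is_cochain psi -> is_cochain (phi - psi).
Proof.
move=> [lphi cphi] [lpsi cpsi]; split=> [a i c x y|a]; rewrite !formBE.
  by rewrite lphi lpsi mulrBr opprD addrACA.
by rewrite mulrBr -cphi -cpsi.
Qed.

Lemma cobdryB n (phi psi : form n) :
  cobdry (phi - psi) = cobdry phi - cobdry psi.
Proof.
apply/funext => a; rewrite formBE /cobdry formBE mulrBr opprD addrACA -sumrB.
by congr (_ + _); apply: eq_bigr => j _; rewrite formBE mulrBr.
Qed.

Lemma cochain0 n : is_cochain (0 : form n).
Proof. by split=> [a i c x y|a]; rewrite mulr0 ?addr0. Qed.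

Lemma cobdry0 n : cobdry (0 : form n) = 0.
Proof. by rewrite -[X in cobdry X](subrr 0) cobdryB subrr. Qed.

Definition cocycle_pred n : {pred (form n)} := fun phi => `[< is_cocycle phi >].

Lemma cocycle_zmod n : zmod_closed (@cocycle_pred n).
Proof.
split=> [|phi psi /asboolP[cphi zphi] /asboolP[cpsi zpsi]]; apply/asboolP.
  by split=> [|a]; [exact: cochain0 | rewrite cobdry0].
split=> [|a]; first exact: cochainB.
by rewrite cobdryB formBE zphi zpsi subrr.
Qed.

HB.instance Definition _ n :=
  GRing.isZmodClosed.Build _ (@cocycle_pred n) (@cocycle_zmod n).

Record cocycle n := Cocycle {
  cocycle_fun :> form n;
  cocycleP : cocycle_fun \in @cocycle_pred n
}.

HB.instance Definition _ n := [isSub for @cocycle_fun n].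
HB.instance Definition _ n := [Choice of cocycle n by <:].
HB.instance Definition _ n := [SubChoice_isSubZmodule of cocycle n by <:].

(** As [cobdry] maps cochains to cocycles, no coboundary is lost by testing
    [is_coboundary] on cocycles only. *)
Definition coboundary_pred n : {pred (cocycle n)} :=
  fun z => `[< is_coboundary (z : form n) >].

Lemma coboundary_zmod n : zmod_closed (@coboundary_pred n).
Proof.
case: n => [|n]; split=> [|x y /asboolP /= hx /asboolP /= hy];
  apply/asboolP => //=.
- by rewrite hx hy subrr.
- by exists 0; [exact: cochain0 | rewrite cobdry0].
case: hx hy => [u cu ->] [v cv ->].
by exists (u - v); [exact: cochainB | rewrite cobdryB].
Qed.

HB.instance Definition _ n :=
  GRing.isZmodClosed.Build _ (@coboundary_pred n) (@coboundary_zmod n).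

Definition HC n : zmodType := {ideal_quot @coboundary_pred n}.

Definition HC_class n (z : cocycle n) : HC n :=
  \pi_({ideal_quot @coboundary_pred n})%qT z.

End TwistedCyclicCohomology.

(** Elements of the [(n+1)]-st tensor power of [B], as formal linear
    combinations of elementary tensors, and the linear functional on the tensor
    power given by a multilinear form [phi] *)
Definition tensor_power (C : numClosedFieldType) (B : algType C) (n : nat) :=
  seq (C * {ffun 'I_n.+1 -> B}).

Definition tensor_eval (C : numClosedFieldType) (B : algType C) (n : nat)
    (phi : {ffun 'I_n.+1 -> B} -> C) (t : tensor_power B n) : C :=
  \sum_(p <- t) p.1 * phi p.2.

(** The quantum trace of the elementary tensor [A 0 ⊗ ... ⊗ A n] *)
Definition qtrace (C : numClosedFieldType) (U : hopfStarAlgType C)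
    (B : algType C) (k : U) (m : nat) (rho : opStarRep U m) (n : nat)
    (A : 'I_n.+1 -> 'M[B]_m) : tensor_power B n :=
  [seq (rho k (j ord_max) (j ord0),
        [ffun i : 'I_n.+1 => A i (j (inord i)) (j (inord i.+1))])
     | j : {ffun 'I_n.+2 -> 'I_m}].

(* Main.v *)
Require Import Defs.
From HB Require Import structures.
From mathcomp Require Import freeg.
From mathcomp Require Import all_boot all_order all_algebra.
From mathcomp Require Import boolp functions reals complex.
From mathcomp Require Import zify.

Set Implicit Arguments.
Unset Strict Implicit.
Unset Printing Implicit Defensive.

Import GRing.Theory Num.Theory.
Local Open Scope ring_scope.

(** The pairing is [Phi] evaluated on [Tr(P, ..., P)], where [Tr] closes the
    matrix product up with the matrix [r = rho(k)].  For a square matrix [r] over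
    [C] and a form [phi] on [B], the expression [phi(Tr(A_0, ..., A_n))] is the
    function [qtr_form r phi] of the matrices [A_i].

    Everything rests on one commutation rule.  As [k] is group-like, invariance
    of [X] at [f = k] reads [k |> X = rho(k) X rho(k)^-1], that is,
    [lam(X) r = r X] ([twisted_comm]).  On matrices with this property the twist
    of [phi] by [lam] is cancelled by [r], so that [qtr_form r phi] is an ordinary
    (untwisted) cyclic cochain, and a cocycle if [phi] is one
    ([qtr_form_cyclic], [qtr_form_cobdry]).

    - Coboundaries.  If [psi] is a cyclic cochain of odd degree and [P] is an
      idempotent commuting with [r] in the twisted sense, rotating the arguments
      of [s := qtr_form r psi (fun=> P)] gives [s = - s], hence [s = 0]; every
      term of the coboundary of [psi] at [P, ..., P] equals [s] up to sign.

    - Murray-von Neumann equivalence.  After compressing [V] and its adjoint [W],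
      the four blocks [WV = P], [V], [W], [VW = Q] multiply like matrix units, and
      in the algebra of matrices of size [m1 + m2] one moves from [P] to [Q] by
      three steps
        [[P 0; 0 0]] -> [[P 0; V 0]] -> [[0 W; 0 Q]] -> [[0 0; 0 Q]].
      Two consecutive idempotents [E], [F] satisfy either [EF = E], [FE = F] or
      [EF = F], [FE = E], as two idempotents with a common kernel or a common
      image do.
      The claim is therefore that a cyclic cocycle of even degree agrees on such
      [E] and [F].  Since products of letters in [{E, F}] only delete letters, the
      cocycle condition becomes the simplicial one on words in two letters, and
      the claim is the purely combinatorial [cyclic_word_cocycle_const].  This is
      a discrete form of the usual argument with the path [E + t (F - E)], along
      which the derivative vanishes because it is an inner derivation.

    - Twisted commutation of [V] and [W].  The intertwining property of [V] at
      [k] gives it for [V]; for [W], the dagger of [V], it follows from the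
      intertwining property at the group-like element [k^*], because the dagger
      exchanges [k] and [k^*].

    - Sums.  In a block diagonal trace the paths of indices which change block
      contribute zero, whence additivity ([qtr_form_dsum]). *)

(** * Words with one letter inserted or deleted *)

(** Locked, so that unfolding finite functions stops at inserted words. *)
HB.lock Definition insert_at (T : finType) n (h : 'I_n.+1) (x : T)
    (v : {ffun 'I_n -> T}) : {ffun 'I_n.+1 -> T} :=
  [ffun l => if unlift h l is Some i then v i else x].

Arguments insert_at {T n} h x v.

Section Insertion.
Variable T : finType.

Definition delete_at n (h : 'I_n.+1) (w : {ffun 'I_n.+1 -> T}) :
    {ffun 'I_n -> T} :=
  [ffun i => w (lift h i)].

Lemma delete_atE n (h : 'I_n.+1) (w : {ffun 'I_n.+1 -> T}) i :
  delete_at h w i = w (lift h i).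
Proof. exact: ffunE. Qed.

Lemma insert_at_hole n (h : 'I_n.+1) (x : T) (v : {ffun 'I_n -> T}) :
  insert_at h x v h = x.
Proof. by rewrite insert_at.unlock ffunE unlift_none. Qed.

Lemma insert_at_lift n (h : 'I_n.+1) (x : T) (v : {ffun 'I_n -> T}) i :
  insert_at h x v (lift h i) = v i.
Proof. by rewrite insert_at.unlock ffunE liftK. Qed.

Lemma insert_atK n (h : 'I_n.+1) (x : T) (v : {ffun 'I_n -> T}) :
  delete_at h (insert_at h x v) = v.
Proof. by apply/ffunP => i; rewrite ffunE insert_at_lift. Qed.

Lemma delete_atK n (h : 'I_n.+1) (w : {ffun 'I_n.+1 -> T}) :
  insert_at h (w h) (delete_at h w) = w.
Proof.
apply/ffunP => l; rewrite insert_at.unlock ffunE.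
by case: unliftP => [i|] ->; rewrite ?ffunE.
Qed.

Lemma insert_at_val n (h : 'I_n.+1) (x : T) (v : {ffun 'I_n -> T})
    (l : 'I_n.+1) (i : 'I_n) :
  l = bump h i :> nat -> insert_at h x v l = v i.
Proof.
move=> li; rewrite -(insert_at_lift h x v); congr (insert_at _ _ _ _).
exact: val_inj.
Qed.

Lemma insert_atE n (h : 'I_n.+2) (x : T) (v : {ffun 'I_n.+1 -> T}) l :
  insert_at h x v l = if (l < h)%N then v (inord l)
                      else if l == h :> nat then x else v (inord l.-1).
Proof.
have [lh|hl|/val_inj <-] := ltngtP (l : nat) (h : nat); last exact: insert_at_hole.
  apply: insert_at_val; rewrite /bump inordK; last by have := ltn_ord h; lia.
  by rewrite leqNgt lh.
apply: insert_at_val; rewrite /bump inordK; last by have := ltn_ord l; lia.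
by lia.
Qed.

Lemma sum_insert_at (V : nmodType) n (h : 'I_n.+1) (P : pred {ffun 'I_n.+1 -> T})
    (F : {ffun 'I_n.+1 -> T} -> V) :
  \sum_(w | P w) F w =
  \sum_(v : {ffun 'I_n -> T}) \sum_(x | P (insert_at h x v)) F (insert_at h x v).
Proof.
rewrite pair_big_dep /= (reindex (fun p => insert_at h p.2 p.1)) //=.
exists (fun w => (delete_at h w, w h)) => [[v x]|w] _ /=.
  by rewrite insert_atK insert_at_hole.
exact: delete_atK.
Qed.

End Insertion.

(** * Cyclic cocycles on words in two letters *)
Section Words.
Variable C : numDomainType.

Lemma sumr_alt m : \sum_(i < m) (-1) ^+ i = (odd m)%:R :> C.
Proof.
elim: m => [|m IHm]; first by rewrite big_ord0.
rewrite big_ord_recr /= IHm -signr_odd.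
by case: (odd m); rewrite ?addrN ?add0r // expr1 subrr.
Qed.

Variables (n : nat) (tau : {ffun 'I_n.+1 -> bool} -> C).
Hypothesis tau_rot : forall w : {ffun _ -> bool},
  tau [ffun i => w (ord_pred i)] = tau w.
Hypothesis tau_cocycle : forall w : {ffun 'I_n.+2 -> bool},
  \sum_(i < n.+2) (-1) ^+ i * tau (delete_at i w) = 0.

Let weight m (w : {ffun 'I_m -> bool}) : nat := (\sum_i w i)%N.
Let level_sum p := \sum_(w | weight w == p) tau w.
Let head_sum p :=
  \sum_(v : {ffun 'I_n -> bool} | weight v == p) tau (insert_at ord0 true v).

Lemma weight_insert_at m h x (v : {ffun 'I_m -> bool}) :
  weight (insert_at h x v) = (x + weight v)%N.
Proof.
rewrite /weight (@bigD1_ord _ _ _ _ h) //= insert_at_hole; congr addn.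
by apply: eq_bigr => i _; rewrite insert_at_lift.
Qed.

(** Expand [tau w] by the cocycle condition at the word [w] with [true] put in
    front.  Deleting position [i] from all words of weight [p] gives every word
    of weight [p] (the letter [false] was deleted) and every word of weight [p.-1]
    ([true] was deleted) exactly once; this does not depend on [i], and the
    alternating sum over the odd number [n.+1] of positions leaves one copy. *)
Lemma word_sum_split p :
  odd n.+1 -> level_sum p = head_sum p + (if p is q.+1 then head_sum q else 0).
Proof.
move=> odd_n.
have tauE w : tau w =
    \sum_(i < n.+1) (-1) ^+ i * tau (insert_at ord0 true (delete_at i w)).
  have := tau_cocycle (insert_at ord0 true w).
  rewrite big_ord_recl mul1r insert_atK => /eqP.
  rewrite addr_eq0 -sumrN => /eqP ->; apply: eq_bigr => i _.
  rewrite exprS !mulN1r mulNr opprK; congr (_ * tau _).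
  apply/ffunP => l; rewrite delete_atE; case: (unliftP ord0 l) => [l'|] ->.
    rewrite insert_at_lift delete_atE (@insert_at_val _ _ _ _ _ _ (lift i l')) //.
    exact: bumpS.
  by rewrite insert_at_hole (_ : lift _ _ = ord0) ?insert_at_hole //; apply: val_inj.
rewrite /level_sum (eq_bigr _ (fun w _ => tauE w)) exchange_big /=.
under eq_bigr => i _.
  rewrite -mulr_sumr (sum_insert_at i).
  rewrite (_ : \sum__ _ = head_sum p + (if p is q.+1 then head_sum q else 0)).
    over.
  under eq_bigr => v _ do under eq_bigr => x _ do rewrite insert_atK.
  under eq_bigr => v _ do rewrite big_mkcond big_bool /= !weight_insert_at.
  rewrite big_split /= addrC; congr (_ + _); last first.
    by case: p => [|q]; rewrite -?big_mkcond //= big1.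
  by rewrite -big_mkcond.
by rewrite -mulr_suml sumr_alt odd_n mul1r.
Qed.

(** Double counting of the pairs of a word of weight [p.+1] and a position at
    which it has the letter [true]; by rotation all positions contribute as much
    as the first one. *)
Lemma word_sum_first p : n.+1%:R * head_sum p = p.+1%:R * level_sum p.+1.
Proof.
pose H (i : 'I_n.+1) :=
  \sum_(w : {ffun 'I_n.+1 -> bool} | (weight w == p.+1) && w i) tau w.
have H0 : H ord0 = head_sum p.
  rewrite /H (sum_insert_at ord0) /head_sum [RHS]big_mkcond; apply: eq_bigr => v _.
  rewrite big_mkcond big_bool /= !weight_insert_at !insert_at_hole andbT andbF addr0.
  by rewrite add1n eqSS.
have HS i : H (ordS i) = H i.
  pose rot (w : {ffun 'I_n.+1 -> bool}) := [ffun i => w (ord_pred i)].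
  rewrite /H (reindex rot) /=; last first.
    exists (fun w : {ffun 'I_n.+1 -> bool} => [ffun i => w (ordS i)]) => w _;
    by apply/ffunP => j; rewrite !ffunE (ordSK, ord_predK).
  apply: eq_big => [w|w _]; last exact: tau_rot.
  rewrite ffunE ordSK; congr ((_ == _) && _).
  rewrite /weight [RHS](reindex_inj (can_inj (@ord_predK n.+1))).
  by apply: eq_bigr => j _; rewrite ffunE.
have HE i : H i = head_sum p.
  case: i; elim=> [|i IHi] lti.
    by rewrite -H0; congr H; apply: val_inj.
  rewrite -(IHi (ltnW lti)) -[RHS]HS; congr H; apply: val_inj => /=.
  by rewrite modn_small.
have -> : n.+1%:R * head_sum p = \sum_(i < n.+1) H i.
  by rewrite (eq_bigr _ (fun i _ => HE i)) sumr_const card_ord mulr_natl.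
rewrite (exchange_big_dep (fun w => weight w == p.+1)) /= => [|i w _ /andP[]//].
rewrite mulr_sumr.
apply: eq_bigr => w /eqP wE; rewrite -wE /weight.
rewrite natr_sum mulr_suml big_mkcond; apply: eq_bigr => i _.
by rewrite eqxx; case: (w i); rewrite ?mul1r ?mul0r.
Qed.

(** The two counts combine to [(n.+1 - p) level_sum p = p.+1 level_sum p.+1], so
    that [level_sum p] is the binomial coefficient ['C(n.+1, p)] times
    [level_sum 0]; compare [p = 0] and [p = n.+1]. *)
Lemma cyclic_word_cocycle_const :
  ~~ odd n -> tau [ffun=> true] = tau [ffun=> false].
Proof.
move=> even_n; have odd_n : odd n.+1 := even_n.
have Srec p : p.+1%:R * level_sum p.+1 = n.+1%:R * level_sum p - p%:R * level_sum p.
  apply/eqP; rewrite eq_sym subr_eq [in X in X == _]word_sum_split // mulrDr.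
  rewrite word_sum_first; case: p => [|p]; first by rewrite mulr0 mul0r.
  by rewrite word_sum_first.
have SE p : (p <= n.+1)%N -> level_sum p = 'C(n.+1, p)%:R * level_sum 0%N.
  elim: p => [|p IHp] lep; first by rewrite bin0 mul1r.
  apply: (@mulfI _ p.+1%:R); first by rewrite pnatr_eq0.
  rewrite Srec -mulrBl -natrB 1?ltnW // IHp 1?ltnW // !mulrA -!natrM.
  by rewrite mul_bin_left.
have S0 : level_sum 0%N = tau [ffun=> false].
  rewrite /level_sum (big_pred1 [ffun=> false]) // => w /=.
  rewrite sum_nat_eq0; apply/forallP/eqP => [w0|-> i]; last by rewrite ffunE.
  by apply/ffunP => i; rewrite ffunE; have := w0 i; case: (w i).
have S1 : level_sum n.+1 = tau [ffun=> true].
  rewrite /level_sum (big_pred1 [ffun=> true]) // => w /=.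
  apply/eqP/eqP => [wn|->]; last first.
    rewrite /weight; under eq_bigr do rewrite ffunE.
    by rewrite sum_nat_const card_ord muln1.
  have : (\sum_(i < n.+1) ~~ w i = 0)%N.
    apply/eqP; rewrite -(eqn_add2l (weight w)) -big_split /= wn addn0; apply/eqP.
    rewrite (eq_bigr (fun=> 1%N)) => [|i _]; last by case: (w i).
    by rewrite sum_nat_const card_ord muln1.
  move/eqP; rewrite sum_nat_eq0 => /forallP w0.
  by apply/ffunP => i; rewrite ffunE; have := w0 i; case: (w i).
by rewrite -S0 -S1 SE // binn mul1r.
Qed.

End Words.

(** * The quantum trace as a cyclic cochain on matrices *)
Section QuantumTrace.
Variables (C : numClosedFieldType) (B : algType C) (lam : algAut B).
Local Notation form n := ({ffun 'I_n.+1 -> B} -> C).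
Local Notation emb := (map_mx (in_alg B)).

(** For [r1 = rho1(k)], [r2 = rho2(k)] and [lam] the action of [k], this is the
    invariance under [k] of [X] as a map between the two representations. *)
Definition twisted_comm m1 m2 (r1 : 'M[C]_m1) (r2 : 'M[C]_m2)
    (X : 'M[B]_(m2, m1)) : Prop :=
  map_mx lam X *m emb r1 = emb r2 *m X.

Definition entry_path m n (A : 'I_n.+1 -> 'M[B]_m)
    (j : {ffun 'I_n.+2 -> 'I_m}) : {ffun 'I_n.+1 -> B} :=
  [ffun i : 'I_n.+1 => A i (j (inord i)) (j (inord i.+1))].

(** For [r = rho(k)], the value of [phi] on the quantum trace of the tensor
    product of the [A i]. *)
Definition qtr_form m (r : 'M[C]_m) n (phi : form n)
    (A : 'I_n.+1 -> 'M[B]_m) : C :=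
  \sum_(j : {ffun 'I_n.+2 -> 'I_m})
    r (j ord_max) (j ord0) * phi (entry_path A j).

Lemma eq_qtr_form m (r : 'M[C]_m) n (phi psi : form n)
    (A A' : 'I_n.+1 -> 'M[B]_m) :
  phi =1 psi -> A =1 A' -> qtr_form r phi A = qtr_form r psi A'.
Proof.
move=> phiE AE; apply: eq_bigr => j _; rewrite phiE; congr (_ * psi _).
by apply/ffunP => i; rewrite !ffunE AE.
Qed.

Lemma multilinear_eq0 n (phi : form n) (a : {ffun 'I_n.+1 -> B}) i :
  multilinear_form phi -> a i = 0 -> phi a = 0.
Proof.
move=> lphi ai0; have aE : upd a i 0 = a.
  by apply/ffunP => l; rewrite ffunE; case: eqVneq => // ->.
have := lphi a i 1 0 0; rewrite scaler0 addr0 mul1r aE => /eqP.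
by rewrite -[X in X == _]addr0 (inj_eq (addrI _)) eq_sym => /eqP.
Qed.

Lemma multilinear_sum n (phi : form n) (I : finType) a i
    (c : I -> C) (y : I -> B) :
  multilinear_form phi ->
  \sum_x c x * phi (upd a i (y x)) = phi (upd a i (\sum_x c x *: y x)).
Proof.
move=> lphi; elim/big_rec2: _ => [|x y1 y2 _ IH]; last by rewrite lphi IH.
by rewrite (multilinear_eq0 (i := i)) // ffunE eqxx.
Qed.

Lemma multilinear_face0 n (phi : form n) :
  multilinear_form phi -> multilinear_form (fun a => phi (face 0 a)).
Proof.
move=> lphi a i c x y.
have fE z : face 0 (upd a i z) =
    upd (face 0 a) (inord i.-1)
      (if i == ord0 then z * a (inord 1)
       else if i == 1%N :> nat then a ord0 * z else z).
  apply/ffunP => l; rewrite !ffunE /=.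
  have -> : (l == inord i.-1) = (l == i.-1 :> nat).
    by rewrite -val_eqE /= inordK //; have := ltn_ord i; lia.
  have eqi k : (k < n.+2)%N -> (inord k == i) = (k == i :> nat).
    by move=> ltk; rewrite -val_eqE /= inordK.
  have l0 : inord 0 = ord0 :> 'I_n.+2 by apply: val_inj; rewrite /= inordK.
  have ltl := ltn_ord l; rewrite !eqi; try lia.
  rewrite -(val_eqE i ord0) /=.
  case: (posnP l) => [->|l_gt0]; last first.
    have -> : ((l.+1 == i :> nat) = (l == i.-1 :> nat)) by lia.
    have [lE|//] := eqVneq.
    have -> : (i == 0 :> nat) = false by lia.
    by have -> : (i == 1 :> nat) = false by lia.
  rewrite l0; have [->|i0] /= := eqVneq (i : nat) 0%N; first by [].
  have [i1|i1] /= := eqVneq (i : nat) 1%N.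
    by have -> : (0%N == i.-1) by lia.
  by case: ifP => //; lia.
rewrite !fE -lphi; congr (phi (upd _ _ _)).
case: ifP => _; first by rewrite mulrDl scalerAl.
by case: ifP => _ //; rewrite mulrDr scalerAr.
Qed.

(** Summing over the last index on the left and over the first one on the right
    leaves the same indices; the remaining entry in front is [lam(A_n) r] on the
    left and [r A_n] on the right. *)
Lemma qtr_form_twrot m (r : 'M[C]_m) n (psi : form n) (A : 'I_n.+1 -> 'M[B]_m) :
    multilinear_form psi -> twisted_comm r r (A ord_max) ->
  qtr_form r (fun a => psi (twrot lam a)) A =
  qtr_form r psi (fun i => A (ord_pred i)).
Proof.
move=> lpsi rA; rewrite /qtr_form (sum_insert_at ord_max) [RHS](sum_insert_at ord0).
apply: eq_bigr => v _.
pose c : {ffun 'I_n.+1 -> B} :=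
  [ffun i => A (ord_pred i) (v (ord_pred i)) (v i)].
have predE (i : 'I_n.+1) : i != ord0 -> ord_pred i = inord i.-1.
  move=> i0; apply: val_inj; rewrite /= inordK; last by have := ltn_ord i; lia.
  have i1 : (0 < i)%N by rewrite lt0n.
  rewrite (_ : (i + n.+1).-1 = i.-1 + n.+1)%N; last by lia.
  by rewrite modnDr modn_small //; have := ltn_ord i; lia.
have pred0 : ord_pred ord0 = ord_max :> 'I_n.+1.
  by apply: val_inj; rewrite /= modn_small.
have LE x : twrot lam (entry_path A (insert_at ord_max x v)) =
    upd c ord0 (lam (A ord_max (v ord_max) x)).
  apply/ffunP => i; rewrite !ffunE; case: eqVneq => [_|i0].
    congr (lam (A _ _ _)); rewrite insert_atE inordK //= ?ltnn ?eqxx //.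
    by rewrite ltnS leqnn; congr (v _); apply: val_inj; rewrite /= inordK.
  have i1 : (0 < i)%N by rewrite lt0n.
  have ltin := ltn_ord i.
  rewrite predE //; congr (A _ _ _); rewrite insert_atE /= !inordK //; try lia.
    by rewrite (_ : (i.-1 < n.+1)%N) //; lia.
  by rewrite prednK // ltin; congr (v _); apply: val_inj; rewrite /= inordK.
have RE x : entry_path (fun i => A (ord_pred i)) (insert_at ord0 x v) =
    upd c ord0 (A ord_max x (v ord0)).
  apply/ffunP => i; rewrite !ffunE; case: eqVneq => [->|i0].
    rewrite pred0; congr (A _ _ _); rewrite insert_atE /= !inordK //=.
    by congr (v _); apply: val_inj; rewrite /= inordK.
  have i1 : (0 < i)%N by rewrite lt0n.
  have ltin := ltn_ord i.
  congr (A _ _ _); rewrite insert_atE /= !inordK //; try lia.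
    by rewrite gtn_eqF // predE.
  by congr (v _); apply: val_inj; rewrite /= inordK.
under eq_bigr => x _.
  rewrite LE insert_at_hole (_ : insert_at _ _ _ ord0 = v ord0); last first.
    by rewrite insert_atE /=; congr (v _); apply: val_inj; rewrite /= inordK.
  over.
under [RHS]eq_bigr => x _.
  rewrite RE insert_at_hole (_ : insert_at _ _ _ ord_max = v ord_max); last first.
    by rewrite insert_atE /=; congr (v _); apply: val_inj; rewrite /= inordK.
  over.
rewrite !multilinear_sum //; congr (psi (upd _ _ _)).
move/matrixP/(_ (v ord_max) (v ord0)): rA; rewrite !mxE => rA.
transitivity (\sum_j map_mx lam (A ord_max) (v ord_max) j * emb r j (v ord0)).
  by apply: eq_bigr => j _; rewrite !mxE mulr_algr.
by rewrite rA; apply: eq_bigr => j _; rewrite !mxE mulr_algl.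
Qed.

Definition mx_face m n (t : nat) (A : 'I_n.+2 -> 'M[B]_m) (i : 'I_n.+1) :
    'M[B]_m :=
  if (i < t)%N then A (inord i)
  else if i == t :> nat then A (inord i) *m A (inord i.+1)
  else A (inord i.+1).

(** Summing over the index between the two multiplied entries yields the entry
    of the matrix product. *)
Lemma qtr_form_face m (r : 'M[C]_m) n (phi : form n) (t : 'I_n.+1)
    (A : 'I_n.+2 -> 'M[B]_m) :
  multilinear_form phi ->
  qtr_form r (fun a => phi (face t a)) A = qtr_form r phi (mx_face t A).
Proof.
move=> lphi; have ltt := ltn_ord t.
rewrite /qtr_form (sum_insert_at (inord t.+1)); apply: eq_bigr => v _.
have hE : (inord t.+1 : 'I_n.+3) = t.+1 :> nat by rewrite inordK //; lia.
have FE x : face t (entry_path A (insert_at (inord t.+1) x v)) =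
    upd (entry_path (mx_face t A) v) t
     (A (inord t) (v (inord t)) x * A (inord t.+1) x (v (inord t.+1))).
  apply/ffunP => i; have lti := ltn_ord i.
  rewrite !ffunE -(val_eqE i t) /mx_face !insert_atE hE /=.
  rewrite !inordK; try lia.
  have [it|ti|/val_inj ->] := ltngtP (i : nat) (t : nat).
  - by rewrite !ltnS it (ltnW it).
  - have -> : (i.+1 < t.+1)%N = false by lia.
    have -> : (i.+1 == t.+1) = false by lia.
    have -> : (i.+2 < t.+1)%N = false by lia.
    by have -> : (i.+2 == t.+1) = false by lia.
  - have -> : (t.+2 < t.+1)%N = false by lia.
    have -> : (t.+2 == t.+1) = false by lia.
    by rewrite leqnn ltnn eqxx.
under eq_bigr => x _.
  rewrite FE (_ : insert_at _ _ _ ord0 = v ord0); last first.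
    by rewrite insert_atE hE /=; congr (v _); apply: val_inj; rewrite /= inordK.
  rewrite (_ : insert_at _ _ _ ord_max = v ord_max); last first.
    rewrite insert_atE hE /=.
    have -> : (n.+2 < t.+1)%N = false by lia.
    have -> : (n.+2 == t.+1) = false by lia.
    by congr (v _); apply: val_inj; rewrite /= inordK.
  rewrite -[phi _]mul1r.
  over.
rewrite -mulr_sumr multilinear_sum //; congr (_ * phi _).
apply/ffunP => i; rewrite ffunE; case: eqVneq => // ->.
rewrite !ffunE /mx_face ltnn eqxx !mxE.
by apply: eq_bigr => x _; rewrite scale1r.
Qed.

(** Reduces the twisted face to an ordinary face and a rotation; it serves to
    avoid a second index computation with [lam]. *)
Lemma last_face_twrot n (a : {ffun 'I_n.+2 -> B}) :
  last_face lam a = face 0 (twrot lam a).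
Proof.
apply/ffunP => i; rewrite !ffunE -!val_eqE /= inordK; last first.
  by have := ltn_ord i; lia.
case: eqVneq => [->|i0] /=; rewrite inordK //; last first.
  by have := ltn_ord i; lia.
by congr (_ * a _); apply: val_inj; rewrite /= inordK.
Qed.

Lemma qtr_form_cobdry m (r : 'M[C]_m) n (phi : form n) (A : 'I_n.+2 -> 'M[B]_m) :
    multilinear_form phi -> twisted_comm r r (A ord_max) ->
  qtr_form r (cobdry lam phi) A =
  \sum_(t < n.+1) (-1) ^+ t * qtr_form r phi (mx_face t A)
  + (-1) ^+ n.+1 * qtr_form r phi (mx_face 0 (fun i => A (ord_pred i))).
Proof.
move=> lphi rA.
rewrite -(qtr_form_face r (@ord0 n) _ lphi) -qtr_form_twrot //; last first.
  exact: multilinear_face0.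
under eq_bigr do rewrite -(qtr_form_face _ _ _ lphi).
rewrite /qtr_form; under eq_bigr do rewrite mulr_sumr.
rewrite exchange_big mulr_sumr -big_split /=; apply: eq_bigr => j _.
rewrite /cobdry last_face_twrot mulrDr mulrCA; congr (_ + _).
by rewrite mulr_sumr; apply: eq_bigr => t _; rewrite mulrCA.
Qed.

Lemma qtr_form_cyclic m (r : 'M[C]_m) n (phi : form n) (A : 'I_n.+1 -> 'M[B]_m) :
    is_cochain lam phi -> twisted_comm r r (A ord_max) ->
  qtr_form r phi A = (-1) ^+ n * qtr_form r phi (fun i => A (ord_pred i)).
Proof.
move=> [lphi cphi] rA; rewrite -qtr_form_twrot // /qtr_form mulr_sumr.
by apply: eq_bigr => j _; rewrite mulrCA -cphi.
Qed.

(** When the product of two letters is its left factor, face [t] deletes letter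
    [t.+1] and the twisted face, after a rotation, deletes letter [0]; when it is
    the right factor, face [t] deletes letter [t] and the twisted face the last
    letter.  Either way the cocycle condition on words in the two letters is the
    simplicial one, up to a sign. *)
Lemma qtr_form_zero_band m (r : 'M[C]_m) n (phi : form n) (X : bool -> 'M[B]_m) :
    ~~ odd n -> is_cocycle lam phi -> (forall b, twisted_comm r r (X b)) ->
    (forall b c, X b *m X c = X b) \/ (forall b c, X b *m X c = X c) ->
  qtr_form r phi (fun=> X true) = qtr_form r phi (fun=> X false).
Proof.
move=> even_n [cphi zphi] rX absorb; have lphi := cphi.1.
pose tau (w : {ffun 'I_n.+1 -> bool}) := qtr_form r phi (fun i => X (w i)).
have sgn : (-1) ^+ n = 1 :> C by rewrite -signr_odd (negPf even_n).
have tau_rot (w : {ffun 'I_n.+1 -> bool}) :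
    tau [ffun i => w (ord_pred i)] = tau w.
  rewrite /tau [RHS]qtr_form_cyclic // sgn mul1r; apply: eq_qtr_form => // i.
  by rewrite ffunE.
suff tau_cocycle (w : {ffun 'I_n.+2 -> bool}) :
    \sum_(i < n.+2) (-1) ^+ i * tau (delete_at i w) = 0.
  have cE b : tau [ffun=> b] = qtr_form r phi (fun=> X b).
    by apply: eq_qtr_form => // i; rewrite ffunE.
  by rewrite -!cE; exact: cyclic_word_cocycle_const.
have : qtr_form r (cobdry lam phi) (fun i => X (w i)) = 0.
  by rewrite /qtr_form big1 // => j _; rewrite zphi mulr0.
rewrite qtr_form_cobdry //; case: absorb => absorb.
  have faceE (t : 'I_n.+1) :
      qtr_form r phi (mx_face t (fun i => X (w i))) = tau (delete_at (lift ord0 t) w).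
    apply: eq_qtr_form => // i; have lti := ltn_ord i; rewrite delete_atE /mx_face.
    case: ltngtP => it; rewrite ?absorb; congr (X (w _)); apply: val_inj;
      by rewrite /= /bump !inordK; lia.
  have lastE : qtr_form r phi (mx_face 0 (fun i => X (w (ord_pred i)))) =
      tau (delete_at ord0 w).
    rewrite -tau_rot; apply: eq_qtr_form => // i; have lti := ltn_ord i.
    rewrite ffunE delete_atE /mx_face /=; have [i0|i0] := eqVneq (i : nat) 0%N.
      rewrite absorb; congr (X (w _)); apply: val_inj => /=.
      by rewrite i0 /bump /= inordK // !modn_small; lia.
    congr (X (w _)); apply: val_inj => /=; rewrite /bump /= inordK //.
    rewrite (_ : (i.+1 + n.+2).-1 = i + n.+2)%N ?modnDr; last by lia.
    rewrite (_ : (i + n.+1).-1 = i.-1 + n.+1)%N ?modnDr; last by lia.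
    by rewrite !modn_small; lia.
  under eq_bigr do rewrite faceE.
  rewrite lastE exprS sgn mulr1 mulN1r => zt; rewrite big_ord_recl mul1r.
  apply: oppr_inj; rewrite oppr0 -[RHS]zt opprD addrC -sumrN; congr (_ + _).
  by apply: eq_bigr => t _; rewrite exprS mulN1r mulNr opprK.
have faceE (t : 'I_n.+1) :
    qtr_form r phi (mx_face t (fun i => X (w i))) =
    tau (delete_at (widen_ord (leqnSn _) t) w).
  apply: eq_qtr_form => // i; have lti := ltn_ord i; rewrite delete_atE /mx_face.
  case: ltngtP => it; rewrite ?absorb; congr (X (w _)); apply: val_inj;
    by rewrite /= /bump !inordK; lia.
have lastE : qtr_form r phi (mx_face 0 (fun i => X (w (ord_pred i)))) =
    tau (delete_at ord_max w).
  apply: eq_qtr_form => // i; have lti := ltn_ord i.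
  rewrite delete_atE /mx_face /= absorb if_same.
  congr (X (w _)); apply: val_inj => /=; rewrite /bump /= inordK //.
  rewrite (_ : (i.+1 + n.+2).-1 = i + n.+2)%N ?modnDr; last by lia.
  by rewrite !modn_small; lia.
under eq_bigr do rewrite faceE.
by rewrite lastE => zt; rewrite big_ord_recr.
Qed.

(** An index path which changes block somewhere meets a zero entry, so only the
    paths staying in one block contribute. *)
Lemma qtr_form_dsum m1 m2 (r1 : 'M[C]_m1) (r2 : 'M[C]_m2) n (phi : form n)
    (A1 : 'I_n.+1 -> 'M[B]_m1) (A2 : 'I_n.+1 -> 'M[B]_m2) :
  multilinear_form phi ->
  qtr_form (block_mx r1 0 0 r2) phi (fun i => block_mx (A1 i) 0 0 (A2 i)) =
  qtr_form r1 phi A1 + qtr_form r2 phi A2.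
Proof.
move=> lphi; rewrite /qtr_form.
pose F (j : {ffun 'I_n.+2 -> 'I_(m1 + m2)}) :=
  block_mx r1 0 0 r2 (j ord_max) (j ord0)
  * phi (entry_path (fun i => block_mx (A1 i) 0 0 (A2 i)) j).
transitivity (\sum_j F j); first by [].
pose L (j : {ffun 'I_n.+2 -> 'I_m1}) : {ffun 'I_n.+2 -> 'I_(m1 + m2)} :=
  [ffun i => lshift m2 (j i)].
pose R (j : {ffun 'I_n.+2 -> 'I_m2}) : {ffun 'I_n.+2 -> 'I_(m1 + m2)} :=
  [ffun i => rshift m1 (j i)].
have Linj : injective L.
  move=> j j' /ffunP jj'; apply/ffunP => i; have := jj' i; rewrite !ffunE.
  exact: lshift_inj.
have Rinj : injective R.
  move=> j j' /ffunP jj'; apply/ffunP => i; have := jj' i; rewrite !ffunE.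
  exact: rshift_inj.
pose left (x : 'I_(m1 + m2)) := (x < m1)%N.
rewrite (bigID (fun j : {ffun 'I_n.+2 -> 'I_(m1 + m2)} => left (j ord0))) /=.
have mixed (j : {ffun 'I_n.+2 -> 'I_(m1 + m2)}) :
    ~~ [forall i, left (j i) == left (j ord0)] -> F j = 0.
  move=> jmix; have [i ji] : exists i : 'I_n.+1,
      left (j (inord i)) != left (j (inord i.+1)).
    apply/existsP; apply: contraR jmix; rewrite negb_exists => /forallP jall.
    apply/forallP; case; elim=> [|i IHi] lti.
      by apply/eqP; congr (left (j _)); apply: val_inj.
    rewrite -(eqP (IHi (ltnW lti))); have := jall (Ordinal (lti : (i < n.+1)%N)).
    rewrite negbK eq_sym => /eqP jE; apply/eqP; move: jE.
    have -> : inord i.+1 = Ordinal lti by apply: val_inj; rewrite /= inordK.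
    move=> ->; congr (left (j _)); apply: val_inj; rewrite /= inordK //.
    exact: ltnW.
  rewrite /F (multilinear_eq0 (i := i)) ?mulr0 // ffunE; move: ji; rewrite /left.
  case: (splitP (j (inord i))) => x xE; case: (splitP (j (inord i.+1))) => y yE.
  - by [].
  - rewrite (_ : j (inord i) = lshift m2 x); last exact: val_inj.
    rewrite (_ : j (inord i.+1) = rshift m1 y) ?block_mxEur ?mxE //.
    exact: val_inj.
  - rewrite (_ : j (inord i) = rshift m1 x); last exact: val_inj.
    rewrite (_ : j (inord i.+1) = lshift m2 y) ?block_mxEdl ?mxE //.
    exact: val_inj.
  - by [].
congr (_ + _).
  transitivity (\sum_(j in [set L v | v in [set: {ffun 'I_n.+2 -> 'I_m1}]]) F j).
    rewrite big_mkcond [RHS]big_mkcond; apply: eq_bigr => j _.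
    have [/forallP jleft|/mixed->] :=
        boolP [forall i, left (j i) == left (j ord0)]; last by rewrite !if_same.
    congr (if _ then _ else _); apply/idP/imsetP => [j0|[v _ ->]]; last first.
      by rewrite ffunE /left /=.
    have lt i : (j i < m1)%N by have := eqP (jleft i); rewrite j0.
    exists [ffun i => Ordinal (lt i)] => //.
    by apply/ffunP => i; apply: val_inj; rewrite !ffunE.
  rewrite big_imset => [|? ? _ _]; last exact: Linj.
  apply: eq_big => [v|v _]; first by rewrite inE.
  rewrite /F /L !ffunE block_mxEul; congr (_ * phi _); apply/ffunP => i.
  by rewrite !ffunE block_mxEul.
transitivity (\sum_(j in [set R v | v in [set: {ffun 'I_n.+2 -> 'I_m2}]]) F j).
  rewrite big_mkcond [RHS]big_mkcond; apply: eq_bigr => j _.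
  have [/forallP jleft|/mixed->] :=
      boolP [forall i, left (j i) == left (j ord0)]; last by rewrite !if_same.
  congr (if _ then _ else _); apply/idP/imsetP => [j0|[v _ ->]]; last first.
    by rewrite ffunE /left /= -leqNgt leq_addr.
  have ge i : (m1 <= j i)%N.
    by rewrite leqNgt; have /eqP := jleft i; rewrite /left => ->.
  have lt i : (j i - m1 < m2)%N by have := ltn_ord (j i); have := ge i; lia.
  exists [ffun i => Ordinal (lt i)] => //.
  by apply/ffunP => i; apply: val_inj; rewrite !ffunE /= subnKC.
rewrite big_imset => [|? ? _ _]; last exact: Rinj.
apply: eq_big => [v|v _]; first by rewrite inE.
rewrite /F /R !ffunE block_mxEdr; congr (_ * phi _); apply/ffunP => i.
by rewrite !ffunE block_mxEdr.
Qed.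

Lemma twisted_comm_mul m1 m2 m3 (r1 : 'M[C]_m1) (r2 : 'M[C]_m2) (r3 : 'M[C]_m3)
    (X : 'M[B]_(m3, m2)) (Y : 'M[B]_(m2, m1)) :
  twisted_comm r2 r3 X -> twisted_comm r1 r2 Y -> twisted_comm r1 r3 (X *m Y).
Proof.
by rewrite /twisted_comm => rX rY; rewrite map_mxM -mulmxA rY mulmxA rX mulmxA.
Qed.

End QuantumTrace.

(** * Group-like elements *)
Section ConjugateModule.
Variables (C : numClosedFieldType) (W : lmodType C).

(** The complex conjugate of [W]: composing a bilinear map with [star] in both
    arguments gives a map which is bilinear with values in this module, and so
    can be tested against the coproduct. *)
Definition conj_module : Type := W.
HB.instance Definition _ := GRing.Zmodule.on conj_module.

Let conj_scale (c : C) (w : conj_module) : conj_module := c^* *: (w : W).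

Fact conj_scaleA a b w : conj_scale a (conj_scale b w) = conj_scale (a * b) w.
Proof. by rewrite /conj_scale scalerA rmorphM. Qed.
Fact conj_scale1 : left_id 1 conj_scale.
Proof. by move=> w; rewrite /conj_scale rmorph1 scale1r. Qed.
Fact conj_scaleDr : right_distributive conj_scale +%R.
Proof. by move=> a u v; rewrite /conj_scale scalerDr. Qed.
Fact conj_scaleDl w : {morph conj_scale^~ w : a b / a + b}.
Proof. by move=> a b; rewrite /conj_scale rmorphD scalerDl. Qed.

HB.instance Definition _ := GRing.Zmodule_isLmodule.Build C conj_module
  conj_scaleA conj_scale1 conj_scaleDr conj_scaleDl.

Lemma conj_moduleZ (c : C) (w : W) : (c *: (w : conj_module)) = c^* *: w :> W.
Proof. by []. Qed.

End ConjugateModule.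

Lemma star1 (C : numClosedFieldType) (A : starAlgType C) : star (1 : A) = 1.
Proof. by rewrite -[LHS]mul1r -{1}[1]starK -starM mul1r starK. Qed.

Lemma starD (C : numClosedFieldType) (A : starAlgType C) :
  {morph @star C A : x y / x + y}.
Proof. by move=> x y; rewrite -[x]scale1r starP rmorph1 !scale1r. Qed.

Lemma star_alg0 (C : numClosedFieldType) (A : starAlgType C) : star (0 : A) = 0.
Proof. by apply: (addrI (star 0)); rewrite -starD !addr0. Qed.

Lemma starZ (C : numClosedFieldType) (A : starAlgType C) c (x : A) :
  star (c *: x) = c^* *: star x.
Proof. by rewrite -[c *: x]addr0 starP star_alg0 addr0. Qed.

Section GroupLike.
Variables (C : numClosedFieldType) (U : hopfStarAlgType C).

Lemma antipodeV_linear : linear (@antipodeV C U).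
Proof. by move=> c x y; rewrite /antipodeV starP antipode_linear starP conjCK. Qed.

Lemma group_like_star (k : U) : group_like k -> group_like (star k).
Proof.
move=> [kk k1]; split; last by rewrite counit_star k1 rmorph1.
move=> W b [bl br]; rewrite big_seq1 (comul_star k) // big_map /=.
rewrite (kk (conj_module W) (fun x y => b (star x) (star y))) ?big_seq1 //.
by split=> [y c u v|x c u v]; rewrite starP ?bl ?br conj_moduleZ.
Qed.

Section Sweedler.
Variables (W : lmodType C).

Lemma comul_sum_linear (b : U -> U -> W) :
  bilinear_map b -> linear (fun y => \sum_(q <- comul y) b q.1 q.2).
Proof.
move=> bb c f g; rewrite (comul_linear c f g W b bb) big_cat big_map /= scaler_sumr.
congr (_ + _); apply: eq_bigr => p _; have := bb.1 p.2 c p.1 0.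
have b0 : b 0 p.2 = 0.
  by have := bb.1 p.2 (-1) 0 0; rewrite scaler0 addr0 scaleN1r addNr.
by rewrite b0 !addr0.
Qed.

Variable k : U.
Hypothesis k_gl : group_like k.

Lemma group_like_sum (b : U -> U -> W) :
  bilinear_map b -> \sum_(p <- comul k) b p.1 p.2 = b k k.
Proof. by move=> bb; rewrite (k_gl.1 W b bb) big_seq1. Qed.

Lemma group_like_sum3 (t : U -> U -> U -> W) : trilinear_map t ->
  \sum_(p <- comul k) \sum_(q <- comul p.2) t p.1 q.1 q.2 = t k k k.
Proof.
move=> [t1 t2 t3].
rewrite (group_like_sum (b := fun x y => \sum_(q <- comul y) t x q.1 q.2)).
  by rewrite (group_like_sum (b := t k)) //; split.
split=> [y c u v|x]; last by apply: comul_sum_linear; split.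
rewrite scaler_sumr -big_split; apply: eq_bigr => q _; exact: t1.
Qed.

End Sweedler.

Lemma group_like_mulVr (k : U) : group_like k -> antipode k * k = 1.
Proof.
move=> kg; have := antipodel k; rewrite kg.2 scale1r.
rewrite (group_like_sum kg (b := fun x y => antipode x * y)) //.
split=> [y c u v|x c u v]; first by rewrite antipode_linear mulrDl scalerAl.
by rewrite mulrDr scalerAr.
Qed.

Lemma group_like_mulrV (k : U) : group_like k -> k * antipode k = 1.
Proof.
move=> kg; have := antipoder k; rewrite kg.2 scale1r.
rewrite (group_like_sum kg (b := fun x y => x * antipode y)) //.
split=> [y c u v|x c u v]; first by rewrite mulrDl scalerAl.
by rewrite antipode_linear mulrDr scalerAr.
Qed.

(** Both are the inverse of [k]: [antipode (star k)] is the inverse of the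
    group-like element [star k]. *)
Lemma group_like_antipodeV (k : U) : group_like k -> antipodeV k = antipode k.
Proof.
move=> kg; rewrite /antipodeV -[LHS]mulr1 -(group_like_mulrV kg) mulrA.
rewrite -{2}[k]starK -starM group_like_mulrV ?star1 ?mul1r //.
exact: group_like_star.
Qed.

End GroupLike.

(** * Invariance and intertwining at a group-like element *)
Section Invariance.
Variables (C : numClosedFieldType) (U : hopfStarAlgType C).
Variables (B : moduleStarAlgType U) (lam sigma : algAut B) (k : U).
Hypotheses (k_gl : group_like k) (lamE : forall b : B, lam b = act k b).
Hypothesis sigma_act : forall (f : U) (b : B),
       sigma (act f b) = act (antipode (antipode f)) (sigma b).
Local Notation emb := (map_mx (in_alg B)).
Local Notation Sinv := (@antipodeV C U).
Local Notation act_mx f := (map_mx (@act C U B f)).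

Lemma sandwichE m1 m2 m3 m4 (R1 : 'M[C]_(m1, m2)) (Y : 'M[B]_(m2, m3))
    (R2 : 'M[C]_(m3, m4)) i j :
  (emb R1 *m Y *m emb R2) i j = \sum_l \sum_h (R1 i h * R2 l j) *: Y h l.
Proof.
rewrite mxE; apply: eq_bigr => l _; rewrite !mxE mulr_suml; apply: eq_bigr => h _.
by rewrite !mxE mulr_algl mulr_algr scalerA mulrC.
Qed.

Lemma emb_mul m1 m2 m3 (X : 'M[C]_(m1, m2)) (Y : 'M[C]_(m2, m3)) :
  emb (X *m Y) = emb X *m emb Y.
Proof. exact: map_mxM. Qed.

Lemma lam_emb m1 m2 (X : 'M[C]_(m1, m2)) : map_mx lam (emb X) = emb X.
Proof. by apply/matrixP => i j; rewrite !mxE rmorph_alg. Qed.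

Lemma act_mxK (f g : U) m1 m2 (X : 'M[B]_(m1, m2)) :
  f * g = 1 -> act_mx f (act_mx g X) = X.
Proof. by move=> fg; apply/matrixP => i j; rewrite !mxE -actA fg act1. Qed.

Lemma rep_mulK m (rho : opStarRep U m) (f g : U) :
  f * g = 1 -> rho g *m rho f = 1%:M.
Proof. by move=> fg; rewrite -repM fg rep1. Qed.

(** At [f = k] the threefold coproduct collapses to [k, k, k], and [S^-1(k)] is
    the inverse of [k] while [S^-2(k) = k]: invariance reads
    [rho(k)^-1 (k |> X) rho(k) = X]. *)
Lemma invariant_twisted_comm m (rho : opStarRep U m) (X : 'M[B]_m) :
  invariant_mx rho X -> twisted_comm lam (rho k) (rho k) X.
Proof.
move=> /(_ k); rewrite k_gl.2 !scale1r => XE.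
have {}XE : emb (rho (antipode k)) *m act_mx k X *m emb (rho k) = X.
  apply/matrixP => i j; rewrite -[in RHS]XE /adR summxE.
  under [RHS]eq_bigr do rewrite summxE.
  rewrite (group_like_sum3 k_gl (t := fun x y z =>
    (emb (rho (Sinv x)) *m act_mx (Sinv (Sinv y)) X *m emb (rho z)) i j)).
    by rewrite !(group_like_antipodeV k_gl) antipodeK.
  split=> [y z|x z|x y] c u v; rewrite !sandwichE scaler_sumr -big_split;
    apply: eq_bigr => l _; rewrite scaler_sumr -big_split; apply: eq_bigr => h _ /=.
  - by rewrite antipodeV_linear rep_linear !mxE mulrDl scalerDl scalerA mulrA.
  - by rewrite !antipodeV_linear !mxE act_bilinear.1 scalerDr !scalerA mulrC.
  - by rewrite rep_linear !mxE mulrDr scalerDl scalerA mulrCA.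
rewrite /twisted_comm -[in RHS]XE !mulmxA -emb_mul rep_mulK ?group_like_mulVr //.
rewrite map_mx1 mul1mx; congr (_ *m _); apply/matrixP => i j.
by rewrite !mxE lamE.
Qed.

(** Evaluate the intertwining relation on the standard basis vectors, which are
    fixed by the action since [B] is unital. *)
Lemma intertwining_group_like m j (rho1 : opStarRep U j) (rho2 : opStarRep U m)
    (V : 'M[B]_(m, j)) (g : U) : group_like g ->
    (forall (f : U) (x : 'cV[B]_j), pi_op rho2 f (V *m x) = V *m pi_op rho1 f x) ->
  emb (rho2 g) *m act_mx (antipode g) V = V *m emb (rho1 g).
Proof.
move=> g_gl VE.
have piE l (rho : opStarRep U l) (x : 'cV[B]_l) :
    pi_op rho g x = emb (rho g) *m act_mx (antipode g) x.
  apply/matrixP => a b; rewrite /pi_op summxE.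
  rewrite (group_like_sum g_gl (b := fun y z =>
    (emb (rho z) *m act_mx (Sinv y) x) a b)) ?group_like_antipodeV //.
  have E z y : (emb (rho z) *m act_mx (Sinv y) x) a b =
      \sum_h rho z a h *: act (Sinv y) (x h b).
    by rewrite mxE; apply: eq_bigr => h _; rewrite !mxE mulr_algl.
  split=> [z|y] c u v; rewrite !E scaler_sumr -big_split; apply: eq_bigr => h _ /=.
    by rewrite antipodeV_linear act_bilinear.1 scalerDr !scalerA mulrC.
  by rewrite rep_linear !mxE scalerDl scalerA.
have act_unit1 : act (antipode g) 1 = 1 :> B.
  have g1 : act g 1 = 1 :> B by rewrite act_unit g_gl.2 scale1r.
  by rewrite -{1}g1 -actA group_like_mulVr // act1.
apply/matrixP => a b; have := VE g (delta_mx b 0).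
have -> : V *m delta_mx b (0 : 'I_1) = col b V by rewrite colE.
rewrite !piE; have -> : act_mx (antipode g) (delta_mx b (0 : 'I_1)) = delta_mx b 0.
  apply/matrixP => x y; rewrite !mxE; case: (_ && _); first exact: act_unit1.
  exact: raddf0.
rewrite -colE.
have -> : act_mx (antipode g) (col b V) = col b (act_mx (antipode g) V).
  by apply/matrixP => x y; rewrite !mxE.
have cE l (M : 'M[B]_(l, j)) i : col b M i 0 = M i b by rewrite mxE.
by rewrite !colE !mulmxA -!colE => /matrixP/(_ a 0); rewrite !cE.
Qed.

Lemma intertwining_twisted_comm m j (rho1 : opStarRep U j)
    (rho2 : opStarRep U m) (V : 'M[B]_(m, j)) :
    (forall (f : U) (x : 'cV[B]_j), pi_op rho2 f (V *m x) = V *m pi_op rho1 f x) ->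
  twisted_comm lam (rho1 k) (rho2 k) V.
Proof.
move=> /(intertwining_group_like k_gl) VE; rewrite /twisted_comm -{1}[emb _]lam_emb.
rewrite -map_mxM -VE map_mxM lam_emb; congr (_ *m _).
rewrite -[RHS](act_mxK _ (group_like_mulrV k_gl)); apply/matrixP => a b.
by rewrite !mxE; exact: lamE.
Qed.

Lemma dagger_mul m1 m2 m3 (X : 'M[B]_(m1, m2)) (Y : 'M[B]_(m2, m3)) :
  dagger sigma (X *m Y) = dagger sigma Y *m dagger sigma X.
Proof.
apply/matrixP => i j; rewrite !mxE rmorph_sum.
rewrite (big_morph _ (@starD C B) (@star_alg0 C B)).
by apply: eq_bigr => l _; rewrite rmorphM starM !mxE.
Qed.

Lemma dagger_emb m1 m2 (X : 'M[C]_(m1, m2)) :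
  dagger sigma (emb X) = emb (map_mx Num.conj X^T).
Proof. by apply/matrixP => i j; rewrite !mxE rmorph_alg starZ star1. Qed.

(** The dagger turns the relation for [V] at a group-like [g] into the relation
    for its dagger at [star g]; to reach [k], take [g = star k]. *)
Lemma intertwining_dagger_twisted_comm m j (rho1 : opStarRep U j)
    (rho2 : opStarRep U m) (V : 'M[B]_(m, j)) :
    (forall (f : U) (x : 'cV[B]_j), pi_op rho2 f (V *m x) = V *m pi_op rho1 f x) ->
  twisted_comm lam (rho2 k) (rho1 k) (dagger sigma V).
Proof.
have g_gl := group_like_star k_gl.
move=> /(intertwining_group_like g_gl)/(congr1 (@dagger _ _ _ sigma _ _)).
rewrite !dagger_mul !dagger_emb -!rep_star !starK /twisted_comm => <-.
congr (_ *m _); apply/matrixP => a b; rewrite !mxE sigma_act act_star lamE.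
congr (act _ _).
rewrite -(group_like_antipodeV g_gl) antipodeVK -(group_like_antipodeV g_gl).
by rewrite antipodeVK starK.
Qed.

End Invariance.

(** * Coboundaries and equivalent idempotents *)
Section Idempotents.
Variables (C : numClosedFieldType) (B : algType C) (lam : algAut B).
Local Notation form n := ({ffun 'I_n.+1 -> B} -> C).
Local Notation emb := (map_mx (in_alg B)).

Lemma qtr_form0 m (r : 'M[C]_m) n (phi : form n) :
  multilinear_form phi -> qtr_form r phi (fun=> 0) = 0.
Proof.
move=> lphi; rewrite /qtr_form big1 // => j _.
by rewrite (multilinear_eq0 (i := ord0)) ?mulr0 // ffunE mxE.
Qed.

(** With all arguments equal to [P], cyclicity in odd degree gives [s = - s] for
    the value [s] of the cochain, and every face is that value again. *)
Lemma qtr_form_coboundary m (r : 'M[C]_m) n (phi : form n) (P : 'M[B]_m) :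
  ~~ odd n -> is_coboundary lam phi -> P *m P = P -> twisted_comm lam r r P ->
  qtr_form r phi (fun=> P) = 0.
Proof.
case: n phi => [|n] phi /= odd_n.
  by move=> -> _ _; rewrite /qtr_form big1 // => j _; rewrite mulr0.
move=> [psi cpsi ->] PP rP; have lpsi := cpsi.1.
have psi0 : qtr_form r psi (fun=> P) = 0.
  apply/eqP; suff : qtr_form r psi (fun=> P) *+ 2 == 0 by rewrite mulrn_eq0.
  rewrite mulr2n {1}(qtr_form_cyclic cpsi) //.
  by rewrite -signr_odd (negbNE odd_n) mulN1r addNr.
have faceE t : qtr_form r psi (mx_face t (fun=> P)) = 0.
  rewrite -[RHS]psi0; apply: eq_qtr_form => // i; rewrite /mx_face PP.
  by rewrite !if_same.
rewrite qtr_form_cobdry // faceE mulr0 addr0 big1 // => t _.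
by rewrite faceE mulr0.
Qed.

Lemma qtr_form_idempotents m (r : 'M[C]_m) n (phi : form n) (E F : 'M[B]_m) :
    ~~ odd n -> is_cocycle lam phi ->
    twisted_comm lam r r E -> twisted_comm lam r r F ->
    E *m E = E -> F *m F = F ->
    (E *m F = E /\ F *m E = F) \/ (E *m F = F /\ F *m E = E) ->
  qtr_form r phi (fun=> E) = qtr_form r phi (fun=> F).
Proof.
move=> even_n zphi rE rF EE FF EF.
pose X (b : bool) := if b then E else F.
apply: (qtr_form_zero_band (X := X) even_n zphi) => [[]//|].
by case: EF => -[EF FE]; [left|right] => -[] [].
Qed.

Lemma twisted_comm0 m1 m2 (r1 : 'M[C]_m1) (r2 : 'M[C]_m2) :
  twisted_comm lam r1 r2 0.
Proof. by rewrite /twisted_comm map_mx0 mul0mx mulmx0. Qed.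

Lemma twisted_comm_block m1 m2 (r1 : 'M[C]_m1) (r2 : 'M[C]_m2) A11 A12 A21 A22 :
  twisted_comm lam r1 r1 A11 -> twisted_comm lam r2 r1 A12 ->
  twisted_comm lam r1 r2 A21 -> twisted_comm lam r2 r2 A22 ->
  twisted_comm lam (block_mx r1 0 0 r2) (block_mx r1 0 0 r2)
    (block_mx A11 A12 A21 A22).
Proof.
rewrite /twisted_comm => c11 c12 c21 c22.
rewrite !map_block_mx !map_mx0 !mulmx_block !mulmx0 !mul0mx !addr0 !add0r.
by rewrite c11 c12 c21 c22.
Qed.

(** Think of the blocks of [E1, ..., E4] as rank one matrices [v w^T] with
    [w^T v = 1]: first the column [v] moves from the first basis vector to the sum
    of both, then the row [w] moves from the first to the second, then the column
    moves on to the second. *)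
Lemma qtr_form_conj m1 m2 (r1 : 'M[C]_m1) (r2 : 'M[C]_m2) n (phi : form n)
    (V : 'M[B]_(m2, m1)) (W : 'M[B]_(m1, m2)) :
    ~~ odd n -> is_cocycle lam phi ->
    twisted_comm lam r1 r2 V -> twisted_comm lam r2 r1 W ->
    V *m W *m V = V -> W *m V *m W = W ->
  qtr_form r1 phi (fun=> W *m V) = qtr_form r2 phi (fun=> V *m W).
Proof.
move=> even_n zphi rV rW VWV WVW; have lphi := zphi.1.1.
pose r := block_mx r1 0 0 r2.
pose E1 := block_mx (W *m V) 0 0 0 : 'M[B]_(m1 + m2).
pose E2 := block_mx (W *m V) 0 V 0 : 'M[B]_(m1 + m2).
pose E3 := block_mx 0 W 0 (V *m W) : 'M[B]_(m1 + m2).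
pose E4 := block_mx 0 0 0 (V *m W) : 'M[B]_(m1 + m2).
have rWV := twisted_comm_mul rW rV; have rVW := twisted_comm_mul rV rW.
have rE1 : twisted_comm lam r r E1.
  by apply: twisted_comm_block => //; exact: twisted_comm0.
have rE2 : twisted_comm lam r r E2.
  by apply: twisted_comm_block => //; exact: twisted_comm0.
have rE3 : twisted_comm lam r r E3.
  by apply: twisted_comm_block => //; exact: twisted_comm0.
have rE4 : twisted_comm lam r r E4.
  by apply: twisted_comm_block => //; exact: twisted_comm0.
have mulE := (mulmx_block, mulmx0, mul0mx, addr0, add0r, mulmxA, VWV, WVW).
transitivity (qtr_form r phi (fun=> E1)).
  by rewrite (qtr_form_dsum _ _ (fun=> W *m V) (fun=> 0)) // qtr_form0 // addr0.
transitivity (qtr_form r phi (fun=> E2)).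
  by apply: qtr_form_idempotents => //; [| |left; split]; rewrite /E1 /E2 !mulE.
transitivity (qtr_form r phi (fun=> E3)).
  by apply: qtr_form_idempotents => //; [| |right; split]; rewrite /E2 /E3 !mulE.
transitivity (qtr_form r phi (fun=> E4)).
  by apply: qtr_form_idempotents => //; [| |left; split]; rewrite /E3 /E4 !mulE.
by rewrite (qtr_form_dsum _ _ (fun=> 0) (fun=> V *m W)) // qtr_form0 // add0r.
Qed.

End Idempotents.

(** * The pairing *)
Section Pairing.
Variables (C : numClosedFieldType) (U : hopfStarAlgType C).
Variables (B : moduleStarAlgType U) (lam sigma : algAut B) (k : U).
Hypotheses (k_gl : group_like k) (lamE : forall b : B, lam b = act k b).
Hypothesis sigma_act : forall (f : U) (b : B),
       sigma (act f b) = act (antipode (antipode f)) (sigma b).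
Local Notation form n := ({ffun 'I_n.+1 -> B} -> C).

Definition proj_eval n (phi : form n) (P : invProj sigma) : C :=
  qtr_form (ip_rep P k) phi (fun=> ip_mx P).

Lemma tensor_eval_qtrace n (phi : form n) (P : invProj sigma) :
  tensor_eval phi (qtrace k (ip_rep P) (fun=> ip_mx P)) = proj_eval phi P.
Proof. by rewrite /tensor_eval /qtrace big_image. Qed.

Lemma proj_twisted_comm (P : invProj sigma) :
  twisted_comm lam (ip_rep P k) (ip_rep P k) P.
Proof. apply: invariant_twisted_comm => //; exact: ip_inv. Qed.

Lemma proj_eval_equiv n (phi : form n) (P Q : invProj sigma) :
  ~~ odd n -> is_cocycle lam phi -> MvN_equiv P Q ->
  proj_eval phi P = proj_eval phi Q.
Proof.
move=> even_n zphi [V [VP VQ VI]]; set W := dagger sigma V in VP VQ.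
have rV : twisted_comm lam (ip_rep P k) (ip_rep Q k) V.
  exact: intertwining_twisted_comm.
have rW : twisted_comm lam (ip_rep Q k) (ip_rep P k) W.
  exact: intertwining_dagger_twisted_comm.
have PP := ip_idem P; have QQ := ip_idem Q.
have QV : Q *m V = V *m P by rewrite -VP -VQ mulmxA.
(* [V P] may differ from [V]; the compression [V P = Q V] is fixed by [P]
   and by [Q], and so is a partial inverse of [P W]. *)
have WVP : P *m W *m (V *m P) = P by rewrite mulmxA -(mulmxA _ W) VP !PP.
have VWQ : V *m P *m (P *m W) = Q.
  by rewrite -!mulmxA (mulmxA P) PP (mulmxA V) -QV -mulmxA VQ.
rewrite /proj_eval.
have rP := proj_twisted_comm P.
have rVP := twisted_comm_mul rV rP; have rPW := twisted_comm_mul rP rW.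
have := qtr_form_conj even_n zphi rVP rPW.
rewrite WVP VWQ; apply.
  by rewrite mulmxA QV -mulmxA PP.
by rewrite mulmxA PP.
Qed.

Lemma proj_eval_dsum n (phi : form n) (P Q : invProj sigma) :
  multilinear_form phi ->
  proj_eval phi (ip_dsum P Q) = proj_eval phi P + proj_eval phi Q.
Proof. exact: qtr_form_dsum. Qed.

(** [zmodule C] is [C] as a module over the integers, the ring of coefficients. *)
Definition chain_eval n (phi : form n) : {freeg invProj sigma} -> C :=
  fglift (fun P => proj_eval phi P : zmodule C).

Lemma chain_eval_zmod_morphism n (phi : form n) :
  zmod_morphism (chain_eval phi).
Proof.
exact: (@lift_is_additive _ _ (zmodule C) (fun P => proj_eval phi P)).
Qed.

HB.instance Definition _ n (phi : form n) :=
  GRing.isZmodMorphism.Build {freeg invProj sigma} C (chain_eval phi)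
    (chain_eval_zmod_morphism phi).

Lemma chain_evalU n (phi : form n) m P :
  chain_eval phi << m *g P >> = m%:~R * proj_eval phi P.
Proof. by rewrite /chain_eval liftU scalezrE mulrzl. Qed.

Lemma chain_evalE n (phi : form n) x :
  chain_eval phi x = \sum_(P <- dom x) (coeff P x)%:~R * proj_eval phi P.
Proof.
rewrite -{1}[x]freeg_sumE raddf_sum; apply: eq_bigr => P _.
exact: chain_evalU.
Qed.

Lemma proj_evalB n (phi psi : form n) P :
  proj_eval (phi - psi) P = proj_eval phi P - proj_eval psi P.
Proof. by rewrite -sumrB; apply: eq_bigr => j _; rewrite -mulrBr. Qed.

Lemma chain_evalBl n (phi psi : form n) x :
  chain_eval (phi - psi) x = chain_eval phi x - chain_eval psi x.
Proof.
rewrite !chain_evalE -sumrB; apply: eq_bigr => P _.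
by rewrite -mulrBr proj_evalB.
Qed.

Lemma chain_eval_null n (phi : form n) x :
  ~~ odd n -> is_cocycle lam phi -> K0_null x -> chain_eval phi x = 0.
Proof.
move=> even_n zphi; elim=> [|{}x y _ x0 _ y0|P Q PQ|P Q].
- exact: raddf0.
- by rewrite raddfB /= x0 y0 subrr.
- by rewrite raddfB /= !chain_evalU (proj_eval_equiv even_n zphi PQ) subrr.
- rewrite raddfB raddfD /= !chain_evalU proj_eval_dsum ?mulrDr ?subrr //.
  exact: zphi.1.1.
Qed.

Lemma chain_eval_coboundary n (phi : form n) x :
  ~~ odd n -> is_coboundary lam phi -> chain_eval phi x = 0.
Proof.
move=> even_n bphi; rewrite chain_evalE; apply: big1 => P _.
rewrite /proj_eval (qtr_form_coboundary even_n bphi) ?mulr0 ?ip_idem //.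
exact: proj_twisted_comm.
Qed.

(** Defined through chosen representatives; [class_evalE] says that any other
    ones give the same value. *)
Definition class_eval n (x : HC lam n) (p : K0 sigma) : C :=
  chain_eval (repr x) (repr p).

Lemma class_evalE n (z : cocycle lam n) (p : {freeg invProj sigma}) :
  ~~ odd n ->
  class_eval (HC_class z) (\pi_(K0 sigma)%qT p) = chain_eval z p.
Proof.
move=> even_n; rewrite /class_eval.
have /asboolP hz : repr (HC_class z) - z \in @coboundary_pred C B lam n.
  by rewrite Quotient.idealrBE reprK.
have /asboolP hp : repr (\pi_(K0 sigma)%qT p) - p \in @K0_null_pred C U B sigma.
  by rewrite Quotient.idealrBE reprK.
have /asboolP zz := cocycleP z.
set q := repr _ in hp *; apply/eqP.
rewrite -subr_eq0 -[X in X - _](subrK (chain_eval z q)).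
rewrite -addrA -chain_evalBl (chain_eval_coboundary _ even_n hz) add0r.
by rewrite -raddfB /= (chain_eval_null even_n zz hp).
Qed.

Lemma class_evalDl n (x y : HC lam n) (p : K0 sigma) :
  ~~ odd n -> class_eval (x + y) p = class_eval x p + class_eval y p.
Proof.
move=> even_n; have -> : x + y = HC_class (repr x + repr y).
  by rewrite /HC_class raddfD /= !reprK.
rewrite -[x in RHS]reprK -[y in RHS]reprK -[p]reprK !class_evalE //.
have := chain_evalBl (cocycle_fun (repr x + repr y)) (repr y) (repr p).
rewrite (_ : _ - _ = cocycle_fun (repr x)); last by apply/funext => a; exact: addrK.
by move=> ->; rewrite subrK.
Qed.

Lemma class_evalDr n (x : HC lam n) (p q : K0 sigma) :
  ~~ odd n -> class_eval x (p + q) = class_eval x p + class_eval x q.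
Proof.
move=> even_n; have -> : p + q = \pi_(K0 sigma)%qT (repr p + repr q).
  by rewrite raddfD /= !reprK.
by rewrite -[p in RHS]reprK -[q in RHS]reprK -[x]reprK !class_evalE // raddfD.
Qed.

End Pairing.

Theorem corollary4p3 (R : realType) (U : hopfStarAlgType R[i])
    (B : moduleStarAlgType U) (lam : algAut B) (k : U)
    (k_group_like : group_like k)
    (lamE : forall b : B, lam b = act k b)
    (sigma : algAut B)
    (sigma_star : forall b : B, star (sigma b) = aut_inv sigma (star b))
    (sigma_act : forall (f : U) (b : B),
       sigma (act f b) = act (antipode (antipode f)) (sigma b))
    (n : nat) :
  exists pairing : HC lam (2 * n) -> K0 sigma -> R[i],
    [/\ forall x y p, pairing (x + y) p = pairing x p + pairing y p,
        forall x p q, pairing x (p + q) = pairing x p + pairing x q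
      & forall (Phi : cocycle lam (2 * n)) (P : invProj sigma),
          pairing (HC_class Phi) (K0_class P) =
          (-1) ^+ n * (((2 * n)`!)%:R / (n`!)%:R)
          * tensor_eval Phi (qtrace k (ip_rep P) (fun=> ip_mx P))].
Proof.
have even_2n : ~~ odd (2 * n) by rewrite mul2n odd_double.
have evalE := class_evalE k_group_like lamE sigma_act _ _ even_2n.
exists (fun x p => (-1) ^+ n * (((2 * n)`!)%:R / (n`!)%:R) * class_eval k x p).
split=> [x y p|x p q|Phi P]; last first.
- by rewrite evalE chain_evalU mul1r tensor_eval_qtrace.
- by rewrite (class_evalDr k_group_like lamE sigma_act) // mulrDr.
by rewrite (class_evalDl k_group_like lamE sigma_act) // mulrDr.
Qed.
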